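(* Let $\hat\theta$ be a (possibly random) element of $\Theta$ independent of the calibration sample $(U_i)_{i=1}^{n_{\mathrm{cal}}}$, and suppose that, conditional on $\hat\theta$, the random vectors $U_1,\dots,U_{n_{\mathrm{cal}}},U_{\mathrm{new}}$ in $\mathbb R^d$ are exchangeable. Let $\hat\rho_\tau$ be the split-conformal radius computed from the calibration scores $S_i=s_{\hat\theta}(U_i)$. Then $$\mathbb P\big(U_{\mathrm{new}}\in\mathcal U_{\hat\theta,\hat\rho_\tau}\big)\ge\tau.$$
   Context: Let $d\ge1$ and $\Theta\subseteq\mathbb R^p$. For each $\theta\in\Theta$, $s_\theta:\mathbb R^d\to[0,\infty)$ is the gauge function $s_\theta(u)=\inf\{t>0:u\in t\,\mathcal U_{\theta,1}\}$ of a unit set $\mathcal U_{\theta,1}\subseteq\mathbb R^d$, with $(\theta,u)\mapsto s_\theta(u)$ Borel measurable. The uncertainty set of radius $\rho$ is $\mathcal U_{\theta,\rho}=\{u\in\mathbb R^d:s_\theta(u)\le\rho\}$ (with $\mathcal U_{\theta,+\infty}=\mathbb R^d$). Fix $\tau\in(0,1)$ and $n_{\mathrm{cal}}\ge1$. With calibration scores $S_i=s_{\hat\theta}(U_i)$, $i=1,\dots,n_{\mathrm{cal}}$, the split-conformal radius is the order statistic $$\hat\rho_\tau=S_{(k)},\qquad k=\lceil(n_{\mathrm{cal}}+1)\tau\rceil,$$ where $S_{(1)}\le\dots\le S_{(n_{\mathrm{cal}})}$ are the ordered calibration scores and $S_{(n_{\mathrm{cal}}+1)}:=+\infty$. Equivalently,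 $\hat\rho_\tau=\inf\{r>0:\frac{1}{n_{\mathrm{cal}}+1}\sum_{i=1}^{n_{\mathrm{cal}}}\mathbf 1\{S_i\le r\}\ge\tau\}$ with $\inf\emptyset=+\infty$. *)

(* Defs.v *)
From HB Require Import structures.
From mathcomp Require Import all_boot all_order all_algebra all_fingroup.
From mathcomp Require Import all_classical all_reals all_analysis.
From mathcomp Require Import measurable_realfun.
Import Order.TTheory GRing.Theory Num.Theory.
Import numFieldNormedType.Exports.

Set Implicit Arguments.
Unset Strict Implicit.
Unset Printing Implicit Defensive.

Local Open Scope classical_set_scope.
Local Open Scope ring_scope.

(* 'rV[R]_n carries its Borel sigma-algebra, generated by the open sets. *)
HB.instance Definition _ (R : realType) (m n : nat) :=
  Measurable.copy 'M[R]_(m, n) (g_sigma_algebraType (@open 'M[R]_(m, n))).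

(* Measurability on D with respect to the trace sigma-algebra on D.  The
   library's [measurable_fun D f] is vacuous when D is not measurable, so it
   cannot be used for an arbitrary subset D. *)
Definition trace_measurable_fun d d' (T : measurableType d)
    (T' : measurableType d') (D : set T) (f : T -> T') : Prop :=
  forall Y : set T', measurable Y ->
    strace (@measurable d T) D (f @^-1` Y `&` D).

Section Gauge.
Context {R : realType} {V : lmodType R}.

(* Extended-real valued: it is +oo at u when u lies in no t A with t > 0. *)
Definition gauge (A : set V) (u : V) : \bar R :=
  ereal_inf [set t%:E | t in [set t : R | 0 < t /\ [set t *: a | a in A] u]].

Definition uncertainty_set (A : set V) (rho : \bar R) : set V :=
  [set u | (gauge A u <= rho)%E].

End Gauge.

Section SplitConformal.
Context {R : realType}.

(* k-th smallest value for 1 <= k <= n, and +oo for k = n + 1. *)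
Definition order_stat (n : nat) (S : 'I_n -> \bar R) (k : nat) : \bar R :=
  nth +oo%E (sort <=%O (codom S)) k.-1.

Definition conformal_rank (n : nat) (tau : R) : nat :=
  `|Num.ceil (n.+1%:R * tau)|%N.

Definition split_conformal_radius (n : nat) (tau : R)
    (S : 'I_n -> \bar R) : \bar R :=
  order_stat S (conformal_rank n tau).

End SplitConformal.

Section RandomElements.
Local Open Scope ereal_scope.
Context {dO : measure_display} {Omega : measurableType dO} {R : realType}.
Variable P : probability Omega R.

Definition independent_elements d1 d2 (T1 : measurableType d1)
    (T2 : measurableType d2) (X : Omega -> T1) (Y : Omega -> T2) : Prop :=
  forall (A : set T1) (B : set T2), measurable A -> measurable B ->
    P (X @^-1` A `&` Y @^-1` B) = P (X @^-1` A) * P (Y @^-1` B).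

(* g is a version of y |-> P (E | Y = y). *)
Definition cond_prob_version d (T : measurableType d) (Y : {RV P >-> T})
    (E : set Omega) (g : T -> \bar R) : Prop :=
  (distribution P Y).-integrable [set: T] g /\
  forall A : set T, measurable A ->
    \int[distribution P Y]_(y in A) g y = P (Y @^-1` A `&` E).

(* For every permutation s and every measurable B,
   P ((X_s(0), .., X_s(m-1)) \in B | Y) = P ((X_0, .., X_(m-1)) \in B | Y)
   almost surely, i.e., both events have a common version of their
   conditional probability given Y. *)
Definition cond_exchangeable d d' (T : measurableType d)
    (T' : measurableType d') (m : nat) (Y : {RV P >-> T})
    (X : Omega -> m.-tuple T') : Prop :=
  forall (s : 'S_m) (B : set (m.-tuple T')), measurable B ->
    exists2 g : T -> \bar R,
      cond_prob_version Y [set w | B (X w)] g &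
      cond_prob_version Y [set w | B [tuple tnth (X w) (s i) | i < m]] g.

End RandomElements.

(* Main.v *)
Require Import Defs.
From HB Require Import structures.
From mathcomp Require Import all_boot all_order all_algebra all_fingroup.
From mathcomp Require Import all_classical all_reals all_analysis.
From mathcomp Require Import measurable_realfun.
Import Order.TTheory GRing.Theory Num.Theory.
Import numFieldNormedType.Exports.

Local Open Scope classical_set_scope.
Local Open Scope ring_scope.

(** Write X_0, .., X_n for the calibration vectors followed by the new one, and
    W_i for the score of X_i under the random parameter.  The new vector lies in
    the uncertainty set exactly when fewer than k of the W_i are strictly below
    W_n, k being the conformal rank ([le_order_stat]).  Call an index j low when
    fewer than k of the W_i are strictly below W_j.  Two facts give the bound:
    - on every outcome at least k indices are low, ties included
      ([leq_card_rank_lt]);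
    - every index is low with the same probability, since the joint law of the
      parameter and the X_i is invariant under transpositions of the X_i
      ([cond_exchangeable_joint]).
    Hence n + 1 times the probability that n is low is the expected number of
    low indices, which is at least k >= (n + 1) tau
    ([cond_exchangeable_rank]).

    The argument needs the rank events to be measurable sets of pairs
    (parameter, sample), whereas the gauge is only known to be measurable for
    the trace sigma-algebra on Theta x R^d, with Theta arbitrary.  The gauge is
    therefore replaced by an everywhere defined measurable function that agrees
    with it on that domain ([trace_measurable_fun_extension]). *)

(** * Ranks and order statistics *)

(** If fewer than k indices had fewer than k values strictly below theirs, some
    index outside this set would have a minimal value among those outside;
    everything strictly below it would then be inside, and there would be fewer
    than k such values, a contradiction. *)
Lemma leq_card_rank_lt {d : Order.disp_t} {T : orderType d} {I : finType}
    (W : I -> T) {k : nat} : (k <= #|I|)%N ->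
  (k <= #|[pred j | (#|[pred i | (W i < W j)%O]| < k)%N]|)%N.
Proof.
move=> kI; set A := [pred j | _]; rewrite leqNgt; apply/negP => Ak.
have /existsP[j0 j0A] : [exists j, j \notin A].
  rewrite -negb_forall; apply: contraL kI => /forallP allA.
  rewrite -ltnNge (leq_ltn_trans _ Ak)//.
  by apply/subset_leq_card/fintype.subsetP => j _; exact: allA.
have [j jA jmin] := @arg_minP _ _ _ j0 [pred j | j \notin A] W j0A.
have : (#|[pred i | (W i < W j)%O]| <= #|A|)%N.
  apply/subset_leq_card/fintype.subsetP => i; rewrite inE.
  by apply: contraLR => iA; rewrite -leNgt; apply: jmin.
by move=> /leq_ltn_trans/(_ Ak) ltk; case/negP: jA; rewrite inE.
Qed.

(** In the sorted list the entries strictly below u come first, so entry number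
    k - 1 is at least u exactly when there are at most k - 1 of them.  For k > n
    both sides hold: the order statistic is then the default value +oo of [nth],
    and only n values are available. *)
Lemma le_order_stat (R : realType) (n : nat) (S : 'I_n -> \bar R) (u : \bar R)
    (k : nat) : (0 < k)%N ->
  (u <= order_stat S k)%E = (#|[pred i | (S i < u)%E]| < k)%N.
Proof.
case: k => // k _; rewrite ltnS /order_stat /=.
set s := sort _ _.
have sorted_s : sorted <=%O s by apply: sort_sorted; exact: le_total.
have -> : #|[pred i | (S i < u)%E]| = count (< u)%O s.
  by rewrite count_sort codomE count_map enumT cardE size_filter.
have [ck|kc] := leqP (count (< u)%O s) k; last first.
  by apply/negbTE; rewrite -ltNge; apply: nth_count_lt.
have [ks|sk] := ltnP k (size s); last by rewrite nth_default// leey.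
by apply: nth_count_ge => //; rewrite ck ks.
Qed.

(** * Measurable extension from an arbitrary subset *)

Lemma ereal_dense_rat {R : realType} {a b : \bar R} : (a < b)%E ->
  exists q : rat, (a < (ratr q)%:E < b)%E.
Proof.
have between (x y : R) : x < y -> exists q : rat, (x%:E < (ratr q)%:E < y%:E)%E.
  by move=> /rat_in_itvoo[q]; rewrite in_itv/= => h; exists q; rewrite !lte_fin.
case: a b => [x| |] [y| |] //; rewrite ?lte_fin.
- exact: between.
- move=> _; have [|q /andP[xq _]] := between x (x + 1); first by rewrite ltrDl.
  by exists q; rewrite xq ltry.
- move=> _; have [|q /andP[_ qy]] := between (y - 1) y.
    by rewrite ltrBlDr ltrDl.
  by exists q; rewrite qy ltNyr.
- by move=> _; exists 0; rewrite ltry ltNyr.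
Qed.

(** Each set [f > q] with q rational is the trace on D of a measurable set Z_q.
    The supremum of the rationals q such that x belongs to Z_q is measurable on
    the whole space, as only countably many sets are involved, and on D it is
    the supremum of the rationals below f x, which is f x by density. *)
Lemma trace_measurable_fun_extension {d : measure_display}
    {T : measurableType d} {R : realType} {D : set T} {f : T -> \bar R} :
  trace_measurable_fun D f ->
  exists2 F : T -> \bar R, measurable_fun [set: T] F & {in D, F =1 f}.
Proof.
move=> mf.
have /choice[Z ZP] (q : rat) : exists Z : set T, measurable Z /\
    Z `&` D = (f @^-1` `](ratr q)%:E, +oo[%classic) `&` D.
  have [|Z mZ ZD] := mf `](ratr q)%:E, +oo[%classic.
    exact: emeasurable_itv.
  by exists Z.
have ZE q x : D x -> Z q x <-> ((ratr q)%:E < f x)%E.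
  move=> Dx; have /seteqP[/(_ x) ZDf /(_ x) fZD] := (ZP q).2.
  split=> [Zqx|qfx]; last first.
    by apply: (fZD _).1; split=> //=; rewrite in_itv/= andbT.
  by have /= [] := ZDf (conj Zqx Dx); rewrite in_itv/= andbT.
pose F x := ereal_sup [set ((ratr q)%:E : \bar R) | q in [set q | Z q x]].
exists F.
  apply: (measurability _ (ErealGenOInfty.measurableE R)) => //.
  move=> _ [_ [a ->] <-].
  rewrite setTI (_ : _ @^-1` _ =
      \bigcup_q (if a < ratr q then Z q else set0)); last first.
    apply/seteqP; split => [x|x [q _]] /=; rewrite in_itv/= andbT.
      move=> /ereal_sup_gt[_ [q Zqx <-]]; rewrite lte_fin => aq.
      by exists q => //; rewrite aq.
    case: ifP => // aq Zqx; apply: (@lt_le_trans _ _ (ratr q)%:E).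
      by rewrite lte_fin.
    by apply: ereal_sup_ubound; exists q.
  by apply: bigcupT_measurable_rat => q; case: ifP => // _; exact: (ZP q).1.
move=> x /set_mem Dx; apply/eqP; rewrite eq_le; apply/andP; split.
  by apply: ge_ereal_sup => _ [q /ZE qfx <-]; exact/ltW/qfx.
rewrite leNgt; apply/negP => /ereal_dense_rat[q /andP[Fq qf]].
move: Fq; rewrite ltNge => /negP; apply; apply: ereal_sup_ubound.
by exists q => //; exact/ZE.
Qed.

(** * Ranks of conditionally exchangeable scores *)

Section exchangeable_scores.
Context {dO d d' : measure_display} {Omega : measurableType dO} {R : realType}.
Context {P : probability Omega R}.
Context {T : measurableType d} {T' : measurableType d'}.

(** Integrating a common version of the two conditional probabilities over A
    gives the equality on the rectangles A x B; these form a generating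
    pi-system, so the two joint laws coincide. *)
Lemma cond_exchangeable_joint {m : nat} {Y : {RV P >-> T}}
    {X : Omega -> m.-tuple T'} (mX : measurable_fun [set: Omega] X)
    (exch : cond_exchangeable Y X) (s : 'S_m) (C : set (T * m.-tuple T')) :
  measurable C ->
  P [set w | C (Y w, X w)]
    = P [set w | C (Y w, [tuple tnth (X w) (s i) | i < m])].
Proof.
move=> mC.
have mX' : measurable_fun [set: Omega]
    (fun w => [tuple tnth (X w) (s i) | i < m]).
  apply/measurable_fun_tnthP => i.
  rewrite (_ : _ \o _ = (fun w => tnth (X w) (s i))).
    exact: (proj1 (measurable_fun_tnthP _) mX).
  by apply/funext => w /=; rewrite tnth_mktuple.
have mY : measurable_fun [set: Omega] Y by exact: measurable_funPT.
pose Z1 : {mfun Omega >-> _} := mfun_Sub (mem_set (measurable_fun_pair mY mX)).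
pose Z2 : {mfun Omega >-> _} := mfun_Sub (mem_set (measurable_fun_pair mY mX')).
apply: (measure_unique [set A `*` B | A in measurable & B in measurable]
  (fun=> setT) _ _ _ _ (distribution P Z1) (distribution P Z2)) => //.
- exact: measurable_prod_measurableType.
- move=> _ _ [A1 mA1 [B1 mB1 <-]] [A2 mA2 [B2 mB2 <-]].
  by exists (A1 `&` A2); [exact: measurableI|]; exists (B1 `&` B2);
    [exact: measurableI|rewrite setXI].
- by move=> _; exists setT => //; exists setT => //; rewrite setXTT.
- by rewrite bigcup_const//; exists 0%N.
- move=> _ [A mA [B mB <-]].
  have [g [_ gX] [_ gX']] := exch s B mB.
  rewrite /distribution /pushforward.
  transitivity (\int[distribution P Y]_(y in A) g y)%E.
    by rewrite gX.
  by rewrite gX'.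
- by move=> _; rewrite -ge0_fin_numE//; exact: fin_num_measure.
Qed.

Definition rank_event {m : nat} (F : T * T' -> \bar R) (k : nat)
    (j : 'I_m) :=
  [set x : T * m.-tuple T' |
    (#|[pred i | (F (x.1, tnth x.2 i) < F (x.1, tnth x.2 j))%E]| < k)%N].

(** The complement is the finite union, over the index sets A with at least k
    elements, of the events where every score indexed by A is strictly below
    score j. *)
Lemma measurable_rank_event {m : nat} (F : T * T' -> \bar R) (k : nat)
    (j : 'I_m) :
  measurable_fun [set: T * T'] F -> measurable (rank_event F k j).
Proof.
move=> mF.
pose G i (x : T * m.-tuple T') := F (x.1, tnth x.2 i).
have mG i : measurable_fun setT (G i).
  apply: measurableT_comp => //; apply: measurable_fun_pair => //.
  by apply: (measurableT_comp (measurable_tnth i)).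
pose C := \bigcup_(A in [set A : {set 'I_m} | (k <= #|A|)%N])
  \bigcap_(i in [set` A]) [set x | (G i x < G j x)%E].
have -> : rank_event F k j = ~` C.
  apply/seteqP; split=> x; rewrite /rank_event /=.
    move=> rk [A /= kA Alt]; move: rk; rewrite ltnNge => /negP; apply.
    apply: leq_trans kA _; apply/subset_leq_card/fintype.subsetP => i iA.
    by rewrite inE; exact: Alt.
  move=> nC; rewrite ltnNge; apply/negP => kle; apply: nC.
  exists [set i | (G i x < G j x)%E]%SET; first by rewrite /= cardsE.
  by move=> i /=; rewrite inE.
apply: measurableC; apply: fin_bigcup_measurable => [|A _].
  exact: finite_finset.
apply: fin_bigcap_measurable => [|i _]; first exact: finite_finset.
rewrite -[X in measurable X]setTI; exact: measurable_lte.
Qed.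

(** The left-hand side bounds from below the number of indices of rank less than
    k on every outcome, and the right-hand side is the expectation of that
    number, its m terms being equal by exchangeability. *)
Lemma cond_exchangeable_rank {m : nat} {Y : {RV P >-> T}}
    {X : Omega -> m.-tuple T'} (mX : measurable_fun [set: Omega] X)
    (exch : cond_exchangeable Y X)
    {F : T * T' -> \bar R} (mF : measurable_fun [set: T * T'] F)
    {k : nat} (km : (k <= m)%N) (j : 'I_m) :
  ((k%:R)%:E <= (m%:R)%:E * P [set w |
    (#|[pred i | (F (Y w, tnth (X w) i) < F (Y w, tnth (X w) j))%E]| < k)%N])%E.
Proof.
pose E j := [set w | rank_event F k j (Y w, X w)].
have mE i : measurable (E i).
  rewrite -[E i]setTI; apply: (measurable_fun_pair _ mX) => //.
  exact: measurable_rank_event.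
(* Transposing the sample entries i and j exchanges the two rank events. *)
have PE i : P (E i) = P (E j).
  rewrite /E (cond_exchangeable_joint mX exch (tperm i j)); last first.
    exact: measurable_rank_event.
  congr (P _); apply/funext => w; rewrite /rank_event /=; congr (is_true (_ < _)%N).
  rewrite tnth_mktuple tpermL -!sum1_card.
  rewrite (reindex_inj (@perm_inj _ (tperm i j))); apply: eq_bigl => l.
  by rewrite /= !inE tnth_mktuple tpermK.
have -> : ((m%:R)%:E * P (E j))%E = (\int[P]_w \sum_(i < m) (\1_(E i) w)%:E)%E.
  rewrite ge0_integral_sum//; last first.
  - by move=> i; apply/measurable_EFinP; exact: measurable_indic.
  rewrite (eq_bigr (fun=> P (E j))).
    by rewrite sumr_const card_ord mule_natl.
  by move=> i _; rewrite integral_indic// setIT; exact: PE.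
rewrite -[leLHS]mule1 -(@probability_setT _ _ _ P) -integral_cst//.
apply: ge0_le_integral => //.
- by move=> w _; rewrite lee_fin.
- by apply: emeasurable_sum => i; apply/measurable_EFinP; exact: measurable_indic.
- move=> w _; rewrite sumEFin lee_fin.
  rewrite (eq_bigr (fun i => (i \in [pred i | w \in E i])%:R))//.
  rewrite -natr_sum -big_mkcond sum1_card ler_nat.
  apply: leq_trans (leq_card_rank_lt (fun i => F (Y w, tnth (X w) i)) _) _.
    by rewrite card_ord.
  apply/subset_leq_card/fintype.subsetP => i.
  by rewrite !inE.
Qed.

End exchangeable_scores.

Theorem proposition4 (R : realType) (d p : nat) (hd : (1 <= d)%N)
    (Theta : set 'rV[R]_p)
    (* unit sets and their gauges, finite on R^d *)
    (Uunit : 'rV[R]_p -> set 'rV[R]_d)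
    (gauge_fin : forall theta u, Theta theta ->
       (gauge (Uunit theta) u < +oo)%E)
    (gauge_meas : trace_measurable_fun (Theta `*` [set: 'rV[R]_d])
       (fun x : 'rV[R]_p * 'rV[R]_d => gauge (Uunit x.1) x.2))
    (tau : R) (htau0 : 0 < tau) (htau1 : tau < 1)
    (n : nat) (hn : (1 <= n)%N)
    (dO : measure_display) (Omega : measurableType dO)
    (P : probability Omega R)
    (thetahat : {RV P >-> 'rV[R]_p})
    (hTheta : forall w, Theta (thetahat w))
    (U : 'I_n -> {RV P >-> 'rV[R]_d}) (Unew : {RV P >-> 'rV[R]_d})
    (indep : independent_elements P thetahat
       (fun w => [tuple U i w | i < n]))
    (exch : cond_exchangeable thetahat
       (fun w => [tuple of rcons [tuple U i w | i < n] (Unew w)])) :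
  (tau%:E <= P [set w |
     let S (i : 'I_n) := gauge (Uunit (thetahat w)) (U i w) in
     let rhohat := split_conformal_radius tau S in
     uncertainty_set (Uunit (thetahat w)) rhohat (Unew w)])%E.
Proof.
have [F mF Fgauge] := trace_measurable_fun_extension gauge_meas.
have FE w u : F (thetahat w, u) = gauge (Uunit (thetahat w)) u.
  by rewrite Fgauge//; apply/mem_set; split => //; exact: hTheta.
set X := (fun w => _) in exch.
have Xlast w : tnth (X w) ord_max = Unew w.
  by rewrite (tnth_nth (Unew w)) /= nth_rcons if_same size_tuple card_ord ltnn.
have Xinit w i : tnth (X w) (widen_ord (leqnSn n) i) = U i w.
  rewrite (tnth_nth (Unew w)) /= nth_rcons size_tuple card_ord ltn_ord.
  by rewrite (nth_map i) ?nth_ord_enum// size_enum_ord.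
have mX : measurable_fun [set: Omega] X.
  apply/measurable_fun_tnthP => i; case: (unliftP ord_max i) => [j ->|->].
    rewrite (_ : _ \o _ = U j); first exact: measurable_funPT.
    apply/funext => w /=; rewrite -Xinit; congr tnth.
    by apply/val_inj; rewrite /= /bump leqNgt ltn_ord.
  by rewrite (_ : _ \o _ = Unew); [exact: measurable_funPT|exact/funext].
set k := conformal_rank n tau.
have ntau0 : 0 < n.+1%:R * tau by rewrite mulr_gt0.
have kE : k%:Z = Num.ceil (n.+1%:R * tau).
  by rewrite gez0_abs// ltW// ceil_gt0.
have k0 : (0 < k)%N by rewrite -ltz_nat kE ceil_gt0.
have kn : (k <= n.+1)%N.
  by rewrite -lez_nat kE ceil_le_int ler_piMr// ltW.
have tauk : n.+1%:R * tau <= k%:R by rewrite -[k%:R]/(k%:Z%:~R) kE ceil_ge.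
have kP := cond_exchangeable_rank mX exch mF kn ord_max.
set E := (X in P X) in kP; set E' := (X in P X).
have -> : E' = E.
  apply/funext => w; rewrite /E' /E /uncertainty_set /split_conformal_radius /=.
  rewrite le_order_stat//; congr (is_true (_ < _)%N).
  (* The new score is not strictly below itself, so it does not count in its
     own rank. *)
  rewrite -!sum1_card [RHS]big_mkcond big_ord_recr /= !inE ltxx addn0 -big_mkcond.
  by apply: eq_bigl => i; rewrite !inE Xinit Xlast !FE.
rewrite -(@lee_pmul2l _ n.+1%:R%:E)//.
by apply: le_trans kP; rewrite -EFinM lee_fin.
Qed.
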